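(* For any partitions $\lambda,\mu$ and any $1\le m<n$, $$\mathbb{F}_{\lambda/\mu}(\kappa_1,\dots,\kappa_n\mid\Xi,\mathsf{S})=\sum_{\nu}\mathbb{F}_{\lambda/\nu}(\kappa_1,\dots,\kappa_m\mid\Xi,\mathsf{S})\,\mathbb{F}_{\nu/\mu}(\kappa_{m+1},\dots,\kappa_n\mid\tau^m_{\mathsf{S}}\Xi,\tau^m_{\Xi}\mathsf{S}),$$ where the sum is over all partitions $\nu$ and is finite (only finitely many terms are nonzero).
   Context: Fix a generic parameter $q$, and write $(x;q)_n:=\prod_{i=1}^n(1-xq^{i-1})$, $(x;q)_0:=1$. A partition is a weakly decreasing sequence $\lambda=(\lambda_1\ge\lambda_2\ge\dots\ge0)$ of nonnegative integers with finitely many nonzero entries; $l(\lambda)$ is the number of nonzero parts and $\lambda'$ is the conjugate partition, so the number of parts of $\lambda'$ equal to $j$ is $m_j(\lambda')=\lambda_j-\lambda_{j+1}$. Let $\Xi=(\xi_0,\xi_1,\dots)$ and $\mathsf{S}=(s_0,s_1,\dots)$ be sequences of generic parameters, with fixed square roots $\sqrt{\xi_i},\sqrt{s_i}$. For $k\ge0$ put $\xi_i^{(k)}:=\sqrt{\xi_{i+k}s_{i+k}\xi_i/s_i}$, $s_i^{(k)}:=\sqrt{s_{i+k}\xi_{i+k}s_i/\xi_i}$ (with these roots formed from the fixed ones), and $\tau^k_{\mathsf{S}}\Xi:=(\xi^{(k)}_0,\xi^{(k)}_1,\dots)$, $\tau^k_{\Xi}\mathsf{S}:=(s^{(k)}_0,s^{(k)}_1,\dots)$.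 Square roots for shifted sequences are taken compatibly, so that performing the $l$-fold shift of the pair $(\tau^k_{\mathsf{S}}\Xi,\tau^k_{\Xi}\mathsf{S})$ gives $(\tau^{k+l}_{\mathsf{S}}\Xi,\tau^{k+l}_{\Xi}\mathsf{S})$. Vertex weights: for $i,j,k,l\in\mathbb{Z}_{\ge0}$ (labels of the bottom, left, top, right edge), $$W_{t,s}(i,j;k,l):=\mathbf{1}_{i+j=k+l}\,\mathbf{1}_{i\ge l}\,(s^2/t^2)^{l}\frac{(s^2/t^2;q)_{i-l}(t^2;q)_l}{(s^2;q)_i}\frac{(q;q)_i}{(q;q)_{i-l}(q;q)_l},$$ which depends only on $t^2,s^2$. Partition function: for $a_1,\dots,a_n\in\mathbb{Z}_{\ge0}$ and $L>l(\lambda),l(\mu)$, $$ZW^{(a_1,\dots,a_n)}_{\lambda/\mu}(\kappa_1,\dots,\kappa_n\mid\Xi,\mathsf{S}):=\sum\prod_{r=1}^n\prod_{c=1}^L W_{t_{r,c},\,s^{(r)}_c}(v_{r,c},h_{r,c-1};v_{r-1,c},h_{r,c}),\qquad t_{r,c}^2=\frac{\xi_{r+c}s_{r+c}}{\kappa_r},$$ where the sum is over all nonnegative integers $v_{r,c}$ ($0\le r\le n$, $1\le c\le L$) and $h_{r,c}$ ($1\le r\le n$, $0\le c\le L$) subject to $v_{0,c}=m_c(\lambda')$, $v_{n,c}=m_c(\mu')$, $h_{r,0}=a_r$, $h_{r,L}=0$; the result does not depend on $L$. Set $$\mathbb{F}^{\mathsf s}_{\lambda/\mu}(\kappa_1,\dots,\kappa_n\mid\Xi,\mathsf{S}):=\sum_{a_1+\dots+a_n=\lambda_1-\mu_1}\Bigl(\prod_{i=1}^n(\kappa_is_0/\xi_0)^{a_i}\frac{(\kappa_i^{-1}s_i\xi_i;q)_{a_i}}{(q;q)_{a_i}}\Bigr)ZW^{(a_1,\dots,a_n)}_{\lambda/\mu}(\kappa_1,\dots,\kappa_n\mid\Xi,\mathsf{S}),$$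 $$\mathbb{F}_{\lambda/\mu}(\kappa_1,\dots,\kappa_n\mid\Xi,\mathsf{S}):=\frac{(-\tau^n_\Xi\mathsf{S})^{\mu}}{(-\mathsf{S})^{\lambda}}\frac{\mathsf{c}_{\tau^n_\Xi\mathsf{S}}(\mu)}{\mathsf{c}_{\mathsf{S}}(\lambda)}\,\mathbb{F}^{\mathsf s}_{\lambda/\mu}(\kappa_1,\dots,\kappa_n\mid\Xi,\mathsf{S}),$$ where $\mathsf{c}_{\mathsf{S}}(\lambda):=\prod_{i\ge1}\frac{(s_i^2;q)_{\lambda_i-\lambda_{i+1}}}{(q;q)_{\lambda_i-\lambda_{i+1}}}$ and $(-\mathsf{S})^\lambda:=\prod_{i\ge1}(-s_{i-1})^{\lambda_i}$ (and likewise with $\mathsf S$ replaced by another sequence). *)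

(* Defs.v *)
From HB Require Import structures.
From mathcomp Require Import all_boot all_order all_algebra.
From mathcomp Require Import all_classical.
Set Implicit Arguments.
Unset Strict Implicit.
Unset Printing Implicit Defensive.
Import GRing.Theory.

(* A partition is the weakly decreasing list of its nonzero parts; it is       *)
(* padded by infinitely many zeros.                                            *)
Record intpart := IntPart {
  parts :> seq nat;
  _ : sorted geq parts && (0 \notin parts) }.

HB.instance Definition _ := [isSub for parts].
HB.instance Definition _ := [Choice of intpart by <:].

(* lambda_i, 1-based *)
Definition part (lam : intpart) (i : nat) : nat := nth 0 lam i.-1.

Definition conjugate (lam : intpart) : seq nat :=
  [seq count (fun p => j < p) lam | j <- iota 0 (part lam 1)].

Definition conj_mult (lam : intpart) (j : nat) : nat :=
  count_mem j (conjugate lam).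

Lemma ltn_count_sorted (s : seq nat) (k j : nat) :
  sorted geq s -> (j < count (fun p => k < p) s) = (k < nth 0 s j).
Proof.
have tr : transitive geq by move=> a b c /= ab ca; exact: leq_trans ca ab.
elim: s j => [|x s IHs] j /=; first by rewrite nth_nil.
move=> px; have {}IHs i := IHs i (path_sorted px).
case: (ltnP k x) => kx.
  by case: j => [|j] /=; rewrite add1n ?kx // ltnS IHs.
have le0 i : nth 0 s i <= k.
  case: (ltnP i (size s)) => [/(mem_nth 0) ins|/(nth_default 0) -> //].
  by move/(order_path_min tr)/allP: px => /(_ _ ins) /= /leq_trans; apply.
rewrite add0n IHs [LHS]ltnNge le0.
by case: j => [|j] /=; rewrite ltnNge ?kx ?le0.
Qed.

Lemma conj_multE (lam : intpart) (j : nat) :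
  0 < j -> conj_mult lam j = part lam j - part lam j.+1.
Proof.
case: j => // j _; case: lam => s hs; have ss := proj1 (andP hs).
rewrite /conj_mult /conjugate /part /= count_map.
have le_nth i k : i <= k -> nth 0 s k <= nth 0 s i.
  move=> ik; rewrite leqNgt -(ltn_count_sorted _ _ ss); apply/negP.
  by move/(leq_ltn_trans ik); rewrite (ltn_count_sorted _ _ ss) ltnn.
have := le_nth _ _ (leqnSn j); have := le_nth 0 j isT.
set a := nth 0 s j.+1; set b := nth 0 s j; set N := nth 0 s 0 => bN ab.
have -> : count (preim (fun k => count (fun p => k < p) s) (pred1 j.+1))
            (iota 0 N) = count (fun k => a <= k < b) (iota 0 N).
  apply: eq_count => k /=.
  by rewrite eqn_leq (ltn_count_sorted _ _ ss) leqNgt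
             (ltn_count_sorted _ _ ss) -leqNgt.
have -> : iota 0 N = iota 0 a ++ iota a (b - a) ++ iota b (N - b).
  by rewrite catA -(iotaD 0 a) subnKC // -(iotaD 0 b) subnKC.
rewrite !count_cat.
have in_iota m n (Q : pred nat) (c : bool) :
    (forall k, m <= k < m + n -> Q k = c) -> count Q (iota m n) = c * n.
  move=> Qc; rewrite (@eq_in_count _ _ (fun=> c)); last first.
    by move=> k; rewrite mem_iota => /Qc.
  by case: (c); rewrite ?count_predT ?count_pred0 ?size_iota ?mul1n.
rewrite (in_iota _ _ _ false) ?(in_iota a _ _ true) ?(in_iota b _ _ false).
- by rewrite !mul0n mul1n addn0 add0n.
- by move=> k /andP[bk _]; rewrite [k < b]ltnNge bk andbF.
- by move=> k; rewrite subnKC.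
- by move=> k /=; rewrite add0n => ka; rewrite leqNgt ka.
Qed.

Local Open Scope ring_scope.
Local Open Scope classical_set_scope.

(* (x; q)_n *)
Definition qpoch (K : fieldType) (q x : K) (n : nat) : K :=
  \prod_(i < n) (1 - x * q ^+ i).

(* A pair of sequences (Xi, S) is stored through roots of xi_i s_i and of      *)
(* xi_i / s_i.  This determines xi_i and s_i, and it is exactly the root data  *)
(* needed to form all the shifts: the k-fold shift has                         *)
(*   xi^(k)_i s^(k)_i = xi_(i+k) s_(i+k)  and  xi^(k)_i / s^(k)_i = xi_i / s_i *)
(* so its roots are inherited, and successive shifts are compatible.           *)
Record param_pair (K : fieldType) := ParamPair {
  sqrt_prod : nat -> K;
  sqrt_quot : nat -> K }.

Definition xi (K : fieldType) (P : param_pair K) (i : nat) : K :=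
  sqrt_prod P i * sqrt_quot P i.

Definition ss (K : fieldType) (P : param_pair K) (i : nat) : K :=
  sqrt_prod P i / sqrt_quot P i.

(* The pair (Xi, S) with chosen roots x_i of xi_i and y_i of s_i. *)
Definition pair_of_roots (K : fieldType) (x y : nat -> K) : param_pair K :=
  ParamPair (fun i => x i * y i) (fun i => x i / y i).

(* (tau^k_S Xi, tau^k_Xi S) *)
Definition shift_pair (K : fieldType) (k : nat) (P : param_pair K) :
    param_pair K :=
  ParamPair (fun i => sqrt_prod P (i + k)%N) (sqrt_quot P).

Section ParamFacts.
Variables (K : fieldType) (x y : nat -> K).
Hypotheses (x0 : forall i, x i != 0) (y0 : forall i, y i != 0).
Let P := pair_of_roots x y.

Lemma xi_of_roots i : xi P i = x i ^+ 2.
Proof. by rewrite /xi /= mulrACA mulfV ?mulr1 ?expr2. Qed.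

Lemma ss_of_roots i : ss P i = y i ^+ 2.
Proof. by rewrite /ss /= invf_div (mulrC (x i)) mulrACA mulfV ?mulr1 ?expr2. Qed.

Lemma xi_shift k i :
  xi (shift_pair k P) i = x (i + k)%N * y (i + k)%N * x i / y i.
Proof. by rewrite /xi /= mulrA. Qed.

Lemma ss_shift k i :
  ss (shift_pair k P) i = y (i + k)%N * x (i + k)%N * y i / x i.
Proof. by rewrite /ss /= invf_div mulrA (mulrC (x _)). Qed.

End ParamFacts.

Lemma shift_pair_add (K : fieldType) (k l : nat) (P : param_pair K) :
  shift_pair l (shift_pair k P) = shift_pair (k + l) P.
Proof.
by rewrite /shift_pair /=; congr ParamPair; apply/funext => i; rewrite addnAC addnA.
Qed.

(* The weight W_{t,s}(i,j;k,l), as a function of t2 = t^2 and s2 = s^2. *)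
Definition vertex_weight (K : fieldType) (q t2 s2 : K) (i j k l : nat) : K :=
  if (i + j == k + l)%N && (l <= i)%N then
    (s2 / t2) ^+ l
    * (qpoch q (s2 / t2) (i - l) * qpoch q t2 l / qpoch q s2 i)
    * (qpoch q q i / (qpoch q q (i - l) * qpoch q q l))
  else 0.

(* Row r : 'I_n and column c : 'I_L stand for the 1-based r.+1 and c.+1, and   *)
(* so does tnth kappa r.  Vertical edges are indexed by 0 <= r <= n and        *)
(* horizontal ones by 0 <= c <= L, with widen_ord and lift ord0 sending an     *)
(* index to its value and to its successor.                                    *)
Definition edge_labels (n L : nat) : choiceType :=
  ('M[nat]_(n.+1, L) * 'M[nat]_(n, L.+1))%type.

Definition admissible (n L : nat) (a : {ffun 'I_n -> nat}) (lam mu : intpart)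
    : set (edge_labels n L) :=
  [set vh : edge_labels n L |
    [/\ forall c : 'I_L, vh.1 ord0 c = conj_mult lam c.+1,
        forall c : 'I_L, vh.1 ord_max c = conj_mult mu c.+1,
        forall r : 'I_n, vh.2 r ord0 = a r
      & forall r : 'I_n, vh.2 r ord_max = 0%N]].

Definition ZW (K : fieldType) (q : K) (L n : nat) (a : {ffun 'I_n -> nat})
    (lam mu : intpart) (kappa : n.-tuple K) (P : param_pair K) : K :=
  \sum_(vh \in @admissible n L a lam mu)
    \prod_(r < n) \prod_(c < L)
      vertex_weight q
        (xi P (r.+1 + c.+1)%N * ss P (r.+1 + c.+1)%N / tnth kappa r)
        (ss (shift_pair r.+1 P) c.+1 ^+ 2)
        (vh.1 (lift ord0 r) c)
        (vh.2 r (widen_ord (leqnSn L) c))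
        (vh.1 (widen_ord (leqnSn n) r) c)
        (vh.2 r (lift ord0 c)).

(* The number of columns is the least L exceeding both lengths; ZW takes the   *)
(* same value for all larger L.                                                *)
Definition columns (lam mu : intpart) : nat :=
  (maxn (size lam) (size mu)).+1.

Definition Fs (K : fieldType) (q : K) (lam mu : intpart) (n : nat)
    (kappa : n.-tuple K) (P : param_pair K) : K :=
  \sum_(a \in [set a : {ffun 'I_n -> nat}
                 | (\sum_(i < n) a i + part mu 1 = part lam 1)%N])
    (\prod_(i < n) ((tnth kappa i * ss P 0 / xi P 0) ^+ a i
                    * (qpoch q ((tnth kappa i)^-1 * ss P i.+1 * xi P i.+1) (a i)
                       / qpoch q q (a i))))
    * ZW q (columns lam mu) a lam mu kappa P.

(* c_S(lambda) and (-S)^lambda; the omitted factors are 1. *)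
Definition cnorm (K : fieldType) (q : K) (s : nat -> K) (lam : intpart) : K :=
  \prod_(1 <= i < (size lam).+1)
    (qpoch q (s i ^+ 2) (part lam i - part lam i.+1)
     / qpoch q q (part lam i - part lam i.+1)).

Definition neg_pow (K : fieldType) (s : nat -> K) (lam : intpart) : K :=
  \prod_(1 <= i < (size lam).+1) (- s i.-1) ^+ part lam i.

Definition FF (K : fieldType) (q : K) (lam mu : intpart) (n : nat)
    (kappa : n.-tuple K) (P : param_pair K) : K :=
  neg_pow (ss (shift_pair n P)) mu / neg_pow (ss P) lam
  * (cnorm q (ss (shift_pair n P)) mu / cnorm q (ss P) lam)
  * Fs q lam mu kappa P.

(* Main.v *)
Require Import Defs.
From mathcomp Require Import all_boot all_order all_algebra.
From mathcomp Require Import all_classical.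
Import GRing.Theory.

(* In a configuration of nonzero weight the arrow conservation i + j = k + l   *)
(* determines the horizontal labels from the vertical ones: reading the r-th   *)
(* row of vertical labels as the multiplicities of the conjugate of a          *)
(* partition lambda^r, one gets h_(r,c) =                                      *)
(* lambda^(r-1)_(c+1) - lambda^r_(c+1), and in particular                      *)
(* a_r = lambda^(r-1)_1 - lambda^r_1.  Hence the partition function, together  *)
(* with its boundary factors, is a sum over chains of nested partitions from   *)
(* lambda to mu of products of one-row weights, i.e. a product of one-row      *)
(* transfer matrices, and cutting the chain after m steps gives the branching  *)
(* rule.  The shift by m turns the weight of row r into that of row m + r, and *)
(* the normalizing factors at the intermediate partition cancel.               *)

(** Configurations correspond to chains by [conserving_chain] and [chain_labels_inj], and
    [ZW_chains] turns this into a formula for the partition function. A chain also determines the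
    boundary labels, so the outer sum of [Fs] is absorbed: by [Fs_chain_sum], [Fs] is an entry of a
    product of n one-row matrices indexed by partitions. Branching is then associativity of that
    product, [chain_sumD]; [chain_sum_shift] identifies the rows of the shifted factor with rows
    m+1, ..., n, and [normalization_neq0] permits the cancellation at nu. Chains descend from
    lambda, so only the finitely many nu inside lambda contribute. *)

Lemma geq_trans : transitive geq.
Proof. by move=> a b c /= ab ca; exact: leq_trans ca ab. Qed.

Lemma part_le_part (lam : intpart) (i j : nat) :
  (i <= j -> part lam j.+1 <= part lam i.+1)%N.
Proof.
move=> ij; case: lam => s hs; have [ss _] := andP hs; rewrite /part /=.
case: (ltnP j (size s)) => js; last by rewrite (nth_default _ js).
by apply: (sorted_leq_nth geq_trans leqnn 0%N ss) => //=;
   rewrite inE //; exact: leq_ltn_trans js.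
Qed.

Lemma part_eq0 (lam : intpart) (i : nat) :
  (part lam i.+1 == 0%N) = (size lam <= i)%N.
Proof.
case: lam => s hs; have [_ s0] := andP hs; rewrite /part /=.
case: leqP => [/(nth_default 0%N) -> //|/(mem_nth 0%N)].
by apply: contraTF => /eqP ->.
Qed.

Lemma intpart_inj (lam mu : intpart) :
  (forall i, part lam i.+1 = part mu i.+1) -> lam = mu.
Proof.
move=> eqp; apply/val_inj/(@eq_from_nth _ 0%N) => [|i _]; last exact: (eqp i).
by apply/eqP; rewrite eqn_leq -part_eq0 eqp part_eq0 leqnn
   -part_eq0 -eqp part_eq0 leqnn.
Qed.

Lemma conj_mult_addn (lam : intpart) (i : nat) :
  (conj_mult lam i.+1 + part lam i.+2 = part lam i.+1)%N.
Proof. by rewrite conj_multE // subnK //; exact: part_le_part. Qed.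

Lemma part_tail_sum {lam : intpart} {L i : nat} :
  (size lam <= L)%N -> (i <= L)%N ->
  part lam i.+1 = (\sum_(i <= c < L) conj_mult lam c.+1)%N.
Proof.
move=> lamL iL; have -> : i = (L - (L - i))%N by rewrite subKn.
elim: (L - i)%N (leq_subr i L) => [_|d IHd dL].
  by rewrite subn0 big_geq //; apply/eqP; rewrite part_eq0.
rewrite big_ltn ?ltn_subrL /= ?(leq_ltn_trans _ dL) //.
by rewrite -conj_mult_addn subnSK // IHd // ltnW.
Qed.

Lemma mult_inj {lam mu : intpart} (L : nat) :
  (size lam <= L)%N -> (size mu <= L)%N ->
  (forall c, (c < L)%N -> conj_mult lam c.+1 = conj_mult mu c.+1) -> lam = mu.
Proof.
move=> lamL muL eqm; apply: intpart_inj => i.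
case: (leqP i L) => [iL|/ltnW Li].
  rewrite (part_tail_sum lamL iL) (part_tail_sum muL iL).
  by apply: eq_big_nat => c /andP[_ cL]; rewrite eqm.
have part0 (al : intpart) : (size al <= L)%N -> part al i.+1 = 0%N.
  by move=> alL; apply/eqP; rewrite part_eq0 (leq_trans alL).
by rewrite !part0.
Qed.

(** Cutting [f] at its first zero leaves only nonzero parts; monotonicity keeps [f] zero from there
    on. *)
Lemma intpart_of_fun (f : nat -> nat) (L : nat) :
  (forall i, f i.+1 <= f i)%N -> f L = 0%N ->
  exists2 lam : intpart, (size lam <= L)%N & forall i, part lam i.+1 = f i.
Proof.
move=> fS fL; have fle i j : (i <= j -> f j <= f i)%N.
  by move/subnK <-; elim: (j - i)%N => // d; exact: leq_trans (fS _).
have [k /eqP fk kmin] := ex_minnP (ex_intro (fun k => f k == 0)%N L (introT eqP fL)).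
have wf : sorted geq (mkseq f k) && (0%N \notin mkseq f k).
  apply/andP; split.
    apply/(sortedP 0%N) => i; rewrite size_mkseq => ik.
    by rewrite !nth_mkseq ?(ltnW ik) //; exact: fS.
  apply/mapP => -[i]; rewrite mem_iota add0n => /andP[_ ik] fi.
  by have := kmin i; rewrite -fi eqxx leqNgt ik => /(_ isT).
exists (IntPart wf); first by rewrite /= size_mkseq kmin ?fL.
move=> i; rewrite /part /=; case: (ltnP i k) => ik; first by rewrite nth_mkseq.
by rewrite nth_default ?size_mkseq //; have := fle _ _ ik; rewrite fk leqn0 => /eqP.
Qed.

(** * Nested partitions and chains *)

(** A finite list covering all candidates for partitions inside [s]; sortedness is imposed later by
    [insub]. *)
Fixpoint subseqs_below (s : seq nat) : seq (seq nat) :=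
  if s is x :: s' then
    [::] :: [seq y :: t | y <- iota 1 x, t <- subseqs_below s']
  else [:: [::]].

Lemma mem_subseqs_below (s t : seq nat) :
  0%N \notin t -> (forall i, nth 0 t i <= nth 0 s i)%N -> t \in subseqs_below s.
Proof.
elim: s t => [|x s IHs] [|y t] //=; rewrite inE negb_or eq_sym -lt0n.
  by move=> /andP[y0 _] /(_ 0%N) /=; rewrite leqNgt y0.
move=> /andP[y0 t0] le_ts; rewrite inE; apply/orP; right.
apply/allpairsPdep; exists y, t; split => //.
  by rewrite mem_iota y0 add1n ltnS (le_ts 0%N).
by apply: IHs => // i; exact: (le_ts i.+1).
Qed.

Definition subparts (lam : intpart) : seq intpart :=
  [seq nu <- undup (pmap insub (subseqs_below lam))
     | all (fun i => part nu i.+1 <= part lam i.+1)%N (iota 0 (size nu))].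

Lemma mem_subparts (lam nu : intpart) :
  reflect (forall i, part nu i.+1 <= part lam i.+1)%N (nu \in subparts lam).
Proof.
apply: (iffP idP) => [|le_nl].
  rewrite mem_filter => /andP[/allP le_nl _] i.
  case: (ltnP i (size nu)) => [ilt|]; first by apply: le_nl; rewrite mem_iota.
  by rewrite -part_eq0 => /eqP ->.
rewrite mem_filter mem_undup mem_pmap_sub; apply/andP; split; first exact/allP.
by apply: mem_subseqs_below le_nl; case: nu => s hs; case/andP: (hs).
Qed.

Lemma uniq_subparts (lam : intpart) : uniq (subparts lam).
Proof. by rewrite filter_uniq ?undup_uniq. Qed.

Lemma subparts_refl (lam : intpart) : lam \in subparts lam.
Proof. exact/mem_subparts. Qed.

Lemma subparts_trans {lam mu nu : intpart} :
  mu \in subparts lam -> nu \in subparts mu -> nu \in subparts lam.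
Proof.
move=> /mem_subparts le1 /mem_subparts le2; apply/mem_subparts => i.
exact: leq_trans (le1 i).
Qed.

Lemma size_subparts {lam nu : intpart} :
  nu \in subparts lam -> (size nu <= size lam)%N.
Proof.
move/mem_subparts/(_ (size lam)); have /eqP -> : part lam (size lam).+1 == 0%N.
  by rewrite part_eq0.
by rewrite leqn0 part_eq0.
Qed.

(** The starting partition is left out: the full chain is [lam :: c]. *)
Fixpoint chains (n : nat) (lam : intpart) : seq (seq intpart) :=
  if n is n'.+1 then [seq nu :: c | nu <- subparts lam, c <- chains n' nu]
  else [:: [::]].

Lemma mem_chains (n : nat) (lam : intpart) (c : seq intpart) :
  (c \in chains n lam) =
  (size c == n) && path (fun al be => be \in subparts al) lam c.
Proof.
elim: n lam c => [|n IHn] lam c /=; first by rewrite inE; case: c.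
apply/allpairsPdep/idP => [[nu [d [nul dn ->]]]|].
  by rewrite /= nul; rewrite IHn in dn.
case: c => //= nu d; rewrite eqSS => /and3P[sz nul p].
by exists nu, d; rewrite IHn sz.
Qed.

Lemma uniq_chains (n : nat) (lam : intpart) : uniq (chains n lam).
Proof.
elim: n lam => //= n IHn lam; apply: allpairs_uniq_dep => [||[x s] [y t] _ _ /= [-> ->] //].
  exact: uniq_subparts.
by move=> nu _; exact: IHn.
Qed.

Local Open Scope ring_scope.
Local Open Scope classical_set_scope.

(** * Products of transfer matrices *)

Section ChainSum.
Variable K : fieldType.
Implicit Type w : nat -> intpart -> intpart -> K.

(** The (lam, mu) entry of the product of the matrices [w 0], ..., [w n.-1], each restricted to
    nested pairs. *)
Fixpoint chain_sum (n : nat) w (lam mu : intpart) : K :=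
  if n is n'.+1 then
    \sum_(nu <- subparts lam)
      w 0%N lam nu * chain_sum n' (fun r => w r.+1) nu mu
  else (lam == mu)%:R.

Lemma chain_sum_eq0 n w lam mu : mu \notin subparts lam -> chain_sum n w lam mu = 0.
Proof.
elim: n w lam => [|n IHn] w lam mul /=.
  by case: eqP mul => // ->; rewrite subparts_refl.
rewrite big_seq big1 // => nu nul; rewrite IHn ?mulr0 //.
by apply: contra mul; exact: subparts_trans.
Qed.

Lemma eq_chain_sum n w w' lam mu :
  (forall r al be, (r < n)%N -> w r al be = w' r al be) ->
  chain_sum n w lam mu = chain_sum n w' lam mu.
Proof.
elim: n w w' lam => //= n IHn w w' lam eqw; apply: eq_bigr => nu _.
by rewrite eqw // (IHn _ (fun r => w' r.+1)) // => r al be rn; rewrite eqw.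
Qed.

Lemma sum_pred1 (T : eqType) (r : seq T) (x : T) (F : T -> K) :
  uniq r -> x \in r -> \sum_(y <- r | y == x) F y = F x.
Proof.
move=> ur xr; rewrite -big_filter (_ : [seq _ <- _ | _] = [:: x]) ?big_seq1 //.
exact: filter_pred1_uniq.
Qed.

Lemma chain_sumD m n w lam mu :
  chain_sum (m + n) w lam mu =
  \sum_(nu <- subparts lam)
    chain_sum m w lam nu * chain_sum n (fun r => w (m + r)%N) nu mu.
Proof.
elim: m w lam => [|m IHm] w lam.
  rewrite add0n (eq_bigr (fun nu => if nu == lam then chain_sum n w nu mu else 0)).
    by rewrite -big_mkcond sum_pred1 ?uniq_subparts ?subparts_refl.
  by move=> nu _ /=; rewrite eq_sym; case: eqP; rewrite ?mul1r ?mul0r.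
rewrite /=; under [RHS]eq_bigr do rewrite big_distrl /=.
rewrite exchange_big /= big_seq [RHS]big_seq; apply: eq_bigr => al alam.
rewrite IHm big_distrr /=.
(* The range of nu shrinks from [subparts lam] to [subparts al], since the other entries vanish. *)
rewrite [RHS](bigID [in subparts al]) /= [X in _ = _ + X]big1 ?addr0; last first.
  by move=> nu nual; rewrite chain_sum_eq0 // mulr0 mul0r.
rewrite -[RHS]big_filter [RHS](perm_big (subparts al)); last first.
  apply: uniq_perm => [||nu]; [exact/filter_uniq/uniq_subparts|exact: uniq_subparts|].
  rewrite mem_filter; apply/andP/idP => [[//]|nual].
  by split=> //; exact: subparts_trans nual.
by apply: eq_bigr => nu _; rewrite mulrA.
Qed.

Lemma chain_sumE (x0 : intpart) n w lam mu :
  chain_sum n w lam mu =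
  \sum_(c <- chains n lam | last lam c == mu)
    \prod_(r < n) w r (nth x0 (lam :: c) r) (nth x0 c r).
Proof.
elim: n w lam => [|n IHn] w lam /=.
  by rewrite big_mkcond big_seq1 /=; case: eqP; rewrite ?big_ord0.
rewrite [RHS]big_mkcond big_allpairs_dep; apply: eq_bigr => nu _.
rewrite IHn big_distrr -big_mkcond /=; apply: eq_bigr => c _.
by rewrite big_ord_recl.
Qed.

End ChainSum.

(** * Sums of finite support *)

Lemma fsbig_finite {K : fieldType} {U : choiceType} (t : seq U) (A : set U)
    (F : U -> K) :
  uniq t -> [set` t] `<=` A -> (forall x, A x -> x \notin t -> F x = 0) ->
  \sum_(x \in A) F x = \sum_(x <- t) F x.
Proof.
move=> ut tA F0; rewrite [RHS]fsbig_seq // (fsbig_widen [set` t] A) // => x [Ax /negP]; exact: F0.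
Qed.

(** A change of variables where [f] has to reach only the points at which [F] is nonzero; this lets
    nonconserving configurations drop out. *)
Lemma fsbig_image {K : fieldType} {T : eqType} {U : choiceType} (s : seq T)
    (p : pred T) (f : T -> U) (A : set U) (F : U -> K) :
  uniq s -> {in [pred c in s | p c] &, injective f} ->
  (forall c, c \in s -> p c -> A (f c)) ->
  (forall x, A x -> F x != 0 -> exists2 c, c \in s & p c /\ f c = x) ->
  \sum_(x \in A) F x = \sum_(c <- s | p c) F (f c).
Proof.
move=> us injf fA Fsupp; rewrite (fsbig_finite [seq f c | c <- s & p c]).
- by rewrite big_map big_filter.
- rewrite map_inj_in_uniq ?filter_uniq // => x y.
  by rewrite !mem_filter => /andP[px xs] /andP[py ys]; apply: injf; rewrite inE ?xs ?ys.
- by move=> x /= /mapP[c]; rewrite mem_filter => /andP[pc cs ->]; exact: fA.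
- move=> x Ax xs; apply/eqP; apply: contraNT xs => /(Fsupp x Ax)[c cs [pc <-]].
  by apply/map_f; rewrite mem_filter pc.
Qed.

(** Grouping by the value of [f]; it serves to absorb the sum over boundary labels into the sum over
    chains. *)
Lemma fsbig_fiber {K : fieldType} {T : eqType} {U : choiceType} (s : seq T)
    (p : pred T) (f : T -> U) (A : set U) (F : T -> K) :
  (forall c, c \in s -> p c -> A (f c)) ->
  \sum_(x \in A) \sum_(c <- s | p c && (f c == x)) F c = \sum_(c <- s | p c) F c.
Proof.
move=> fA; rewrite (fsbig_finite (undup [seq f c | c <- s & p c])).
- under eq_bigr do rewrite big_mkcondr.
  rewrite exchange_big /= big_seq_cond [RHS]big_seq_cond.
  apply: eq_bigr => c /andP[cs pc].
  under eq_bigr do rewrite eq_sym.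
  rewrite -big_mkcond (sum_pred1 _ _ _ _ (fun=> F c)) ?undup_uniq //.
  by rewrite mem_undup map_f // mem_filter pc.
- exact: undup_uniq.
- move=> x /=; rewrite mem_undup => /mapP[c]; rewrite mem_filter => /andP[pc cs ->].
  exact: fA.
- move=> x _; rewrite mem_undup => xs; rewrite big_seq_cond big1 // => c.
  move=> /and3P[cs pc /eqP fc]; case/negP: xs; rewrite -fc.
  by apply/map_f; rewrite mem_filter pc.
Qed.

(** * Chains and edge labels *)

Definition chain_labels (n L : nat) (lam : intpart) (c : seq intpart) :
    edge_labels n L :=
  (\matrix_(r, k) conj_mult (nth lam (lam :: c) r) k.+1,
   \matrix_(r, k) (part (nth lam (lam :: c) r) k.+1 - part (nth lam c r) k.+1)%N).

Definition chain_input (n : nat) (lam : intpart) (c : seq intpart) :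
    {ffun 'I_n -> nat} :=
  [ffun r : 'I_n =>
     (part (nth lam (lam :: c) r) 1 - part (nth lam c r) 1)%N].

Lemma chain_step {n : nat} {lam : intpart} {c : seq intpart} (r : nat) :
  c \in chains n lam -> (r < n)%N ->
  nth lam c r \in subparts (nth lam (lam :: c) r).
Proof.
by rewrite mem_chains => /andP[/eqP <- /(pathP lam) cP]; exact: cP.
Qed.

Lemma size_chain {n : nat} {lam : intpart} {c : seq intpart} :
  c \in chains n lam -> size c = n.
Proof. by rewrite mem_chains => /andP[/eqP]. Qed.

Lemma chain_le {n : nat} {lam : intpart} {c : seq intpart} (r : nat) :
  c \in chains n lam -> (r <= n)%N -> nth lam (lam :: c) r \in subparts lam.
Proof.
move=> cn; elim: r => [_|r IHr rn]; first exact: subparts_refl.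
exact: subparts_trans (IHr (ltnW rn)) (chain_step _ cn rn).
Qed.

(** The vertical labels alone separate chains: a partition of length at most [L] is determined by
    its first [L] multiplicities. *)
Lemma chain_labels_inj (n L : nat) (lam : intpart) :
  (size lam <= L)%N ->
  {in chains n lam &, injective (chain_labels n L lam)}.
Proof.
move=> lamL c d cn dn [/matrixP eqv _].
apply: (@eq_from_nth _ lam) => [|r]; first by rewrite (size_chain cn) (size_chain dn).
rewrite (size_chain cn) => rn.
have szL e : e \in chains n lam -> (size (nth lam e r) <= L)%N.
  by move=> en; exact: leq_trans (size_subparts (chain_le r.+1 en rn)) lamL.
apply: (mult_inj L); [exact: szL|exact: szL|move=> k kL].
by have := eqv (lift ord0 (Ordinal rn)) (Ordinal kL); rewrite !mxE.
Qed.

Definition conserving (n L : nat) (vh : edge_labels n L) : Prop :=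
  forall (r : 'I_n) (k : 'I_L),
    (vh.1 (lift ord0 r) k + vh.2 r (widen_ord (leqnSn L) k) =
     vh.1 (widen_ord (leqnSn n) r) k + vh.2 r (lift ord0 k))%N.

(* Summing the conservation law over the columns to the right of a given      *)
(* horizontal edge, its label is the difference of the tail sums of the two   *)
(* adjacent rows of vertical labels; being nonnegative, it forces the         *)
(* partitions read off these rows to be nested.                               *)
Lemma conserving_chain (n L : nat) (a : {ffun 'I_n -> nat}) (lam mu : intpart)
    (vh : edge_labels n L) :
  (size lam <= L)%N -> (size mu <= L)%N ->
  admissible a lam mu vh -> conserving n L vh ->
  exists2 c, c \in chains n lam & last lam c = mu /\ chain_labels n L lam c = vh.
Proof.
move=> lamL muL [vlam vmu _ hmax] cons.
(* Parts are tail sums of multiplicities, so [T r k] is to be part k+1 of the r-th partition. *)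
pose T (r : 'I_n.+1) k := (\sum_(c < L | k <= c) vh.1 r c)%N.
have TS r (k : 'I_L) : T r k = (vh.1 r k + T r k.+1)%N.
  rewrite /T (bigD1 k) //=; congr addn; apply: eq_bigl => c.
  by rewrite ltn_neqAle andbC eq_sym.
have Tdec r k : (T r k.+1 <= T r k)%N.
  case: (ltnP k L) => kL; first by rewrite (TS r (Ordinal kL)) leq_addl.
  rewrite [leqLHS]big_pred0 // => c.
  by apply: contraTF (ltn_ord c) => /ltnW kc; rewrite -leqNgt (leq_trans kL).
have TL r : T r L = 0%N by rewrite /T big_pred0 // => c; rewrite leqNgt ltn_ord.
have /choice[g gP] r : exists al : intpart,
    (size al <= L)%N /\ forall i, part al i.+1 = T r i.
  by have [al] := intpart_of_fun _ _ (Tdec r) (TL r); exists al.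
have gmult r (k : 'I_L) : conj_mult (g r) k.+1 = vh.1 r k.
  by rewrite conj_multE // !(gP r).2 TS addnK.
have g0 : g ord0 = lam.
  by apply: (mult_inj L (gP _).1 lamL) => k kL; rewrite (gmult _ (Ordinal kL)) vlam.
have gmax : g ord_max = mu.
  by apply: (mult_inj L (gP _).1 muL) => k kL; rewrite (gmult _ (Ordinal kL)) vmu.
have TH (r : 'I_n) (k : 'I_L.+1) :
    T (widen_ord (leqnSn n) r) k = (T (lift ord0 r) k + vh.2 r k)%N.
  (* Induction runs leftwards from the right edge, where both tails and the outgoing label
     vanish. *)
  have -> : k = inord (L - (L - k)).
    by apply: val_inj; rewrite /= inordK ?subKn ?ltnS ?leq_subr // -ltnS.
  elim: (L - k)%N (leq_subr k L) => [_|d IHd dL].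
    have -> : inord (L - 0) = ord_max :> 'I_L.+1.
      by apply: val_inj; rewrite /= inordK subn0 /=.
    by rewrite !TL hmax.
  have jL : (L - d.+1 < L)%N by rewrite ltn_subrL (leq_ltn_trans _ dL).
  pose j := Ordinal jL.
  have -> : inord (L - d.+1) = widen_ord (leqnSn L) j.
    by apply: val_inj; rewrite /= inordK /= // ltnW.
  rewrite /= (TS _ j) (TS (lift _ _) j).
  have jd : inord (L - d) = lift ord0 j.
    by apply: val_inj; rewrite /= inordK ?ltnS ?leq_subr // /bump /= add1n subnSK.
  have := IHd (ltnW dL); rewrite jd /= /bump /= add1n => ->.
  by rewrite addnA [RHS]addnAC cons addnAC.
pose c := mkseq (fun r => g (inord r.+1)) n.
have cw (r : 'I_n.+1) : nth lam (lam :: c) r = g r.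
  case: r => -[|r] rn /=; first by rewrite -g0; congr g; apply: val_inj.
  by rewrite nth_mkseq //; congr g; apply: val_inj; rewrite /= inordK.
have cl (r : 'I_n) : nth lam c r = g (lift ord0 r) by rewrite -(cw (lift ord0 r)).
exists c; last split.
- rewrite mem_chains size_mkseq eqxx /=; apply/(pathP lam) => r.
  rewrite size_mkseq => rn; apply/mem_subparts => i.
  rewrite (cl (Ordinal rn)) (cw (widen_ord (leqnSn n) (Ordinal rn))) !(gP _).2.
  case: (leqP i L) => [iL|/ltnW Li].
    by rewrite (TH _ (Ordinal (iL : (i < L.+1)%N))) leq_addr.
  rewrite [leqLHS]big_pred0 // => k.
  by rewrite leqNgt (leq_trans (ltn_ord k)).
- by rewrite (last_nth lam) size_mkseq -[RHS]gmax -cw.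
- rewrite [RHS]surjective_pairing; congr pair; apply/matrixP => r k; rewrite mxE.
    by rewrite cw gmult.
  by rewrite cl (cw (widen_ord (leqnSn n) r)) !(gP _).2 TH addKn.
Qed.

(** * One-row weights *)

Section Branching.
Variables (K : fieldType) (q : K).

Definition boundary_weight (P : param_pair K) (kap : K) (r a : nat) : K :=
  (kap * ss P 0 / xi P 0) ^+ a
  * (qpoch q (kap^-1 * ss P r * xi P r) a / qpoch q q a).

(** Rows [r] count from 1, columns [c] from 0. The horizontal labels are those forced by
    conservation when [lam] lies above [nu]. *)
Definition column_weight (P : param_pair K) (kap : K) (r : nat)
    (lam nu : intpart) (c : nat) : K :=
  vertex_weight q (xi P (r + c.+1)%N * ss P (r + c.+1)%N / kap)
    (ss (shift_pair r P) c.+1 ^+ 2)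
    (conj_mult nu c.+1) (part lam c.+1 - part nu c.+1)
    (conj_mult lam c.+1) (part lam c.+2 - part nu c.+2).

(** Stopping at [size lam] keeps the weight independent of the number of columns, as a matrix entry
    must be. *)
Definition row_weight (P : param_pair K) (kap : K) (r : nat)
    (lam nu : intpart) : K :=
  boundary_weight P kap r (part lam 1 - part nu 1)
  * \prod_(c < size lam) column_weight P kap r lam nu c.

(** No path reaches these vertices, and an empty vertex has weight 1. *)
Lemma column_weight_eq1 P kap r (lam nu : intpart) c :
  (size lam <= c)%N -> (size nu <= c)%N -> column_weight P kap r lam nu c = 1.
Proof.
move=> lamc nuc; have part0 (al : intpart) i : (size al <= i)%N -> part al i.+1 = 0%N.
  by move=> ?; apply/eqP; rewrite part_eq0.
rewrite /column_weight !conj_multE // !part0 ?leqW // /vertex_weight /=.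
by rewrite /qpoch expr0 !big_ord0 !mulr1 !invr1 !mulr1.
Qed.

Lemma row_weight_widen P kap r (lam nu : intpart) L :
  nu \in subparts lam -> (size lam <= L)%N ->
  row_weight P kap r lam nu =
  boundary_weight P kap r (part lam 1 - part nu 1)
  * \prod_(c < L) column_weight P kap r lam nu c.
Proof.
move=> /size_subparts nul lamL; congr (_ * _).
rewrite -!(big_mkord xpredT (column_weight P kap r lam nu)).
rewrite (big_cat_nat (leq0n _) lamL) //= [X in _ = _ * X]big_nat [X in _ = _ * X]big1 ?mulr1 //.
by move=> c /andP[lamc _]; rewrite column_weight_eq1 // (leq_trans nul).
Qed.

Lemma ZW_chains (n L : nat) (a : {ffun 'I_n -> nat}) (lam mu : intpart)
    (kappa : n.-tuple K) (P : param_pair K) :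
  (size lam < L)%N -> (size mu < L)%N ->
  ZW q L a lam mu kappa P =
  \sum_(c <- chains n lam | (last lam c == mu) && (chain_input n lam c == a))
    \prod_(r < n) \prod_(k < L)
      column_weight P (tnth kappa r) r.+1 (nth lam (lam :: c) r) (nth lam c r) k.
Proof.
move=> lamL muL; rewrite /ZW (fsbig_image (chains n lam)
  (fun c => (last lam c == mu) && (chain_input n lam c == a)) (chain_labels n L lam)).
- apply: eq_bigr => c _; apply: eq_bigr => r _; apply: eq_bigr => k _.
  by rewrite /column_weight !mxE.
- exact: uniq_chains.
- move=> c d; rewrite !inE => /andP[cn _] /andP[dn _].
  by apply: chain_labels_inj cn dn; exact: ltnW.
- move=> c cn /andP[/eqP lastc /eqP ac].
  have szc r : (r <= n)%N -> (size (nth lam (lam :: c) r) < L)%N.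
    by move=> rn; exact: leq_ltn_trans (size_subparts (chain_le _ cn rn)) lamL.
  split => r; rewrite /= ?mxE ?ffunE //=.
  + by rewrite -lastc (last_nth lam) (size_chain cn).
  + by rewrite -ac ffunE.
  (* Every partition of the chain is shorter than [L], so nothing leaves through the right edge. *)
  + have part0 (al : intpart) : (size al < L)%N -> part al L.+1 = 0%N.
      by move=> /ltnW alL; apply/eqP; rewrite part_eq0.
    by rewrite !part0 // (szc r, szc r.+1) // ltnW.
- move=> vh adm /prodf_neq0 nz.
  have cons : conserving n L vh.
    move=> r k; have /prodf_neq0/(_ k isT) := nz r isT.
    by rewrite /vertex_weight; case: ifP => [/andP[/eqP]|]; rewrite ?eqxx.
  have [c cn [lastc cvh]] := conserving_chain n L a lam mu vh (ltnW lamL) (ltnW muL) adm cons.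
  exists c => //; split=> //; rewrite lastc eqxx /=; apply/eqP/ffunP => r.
  by case: adm => _ _ <- _; rewrite ffunE -cvh mxE.
Qed.

(** Telescoping along the chain; it places the boundary labels in the index set of the sum in
    [Fs]. *)
Lemma sum_chain_input (n : nat) (lam : intpart) (c : seq intpart) :
  c \in chains n lam ->
  (\sum_(r < n) chain_input n lam c r + part (last lam c) 1 = part lam 1)%N.
Proof.
move=> cn; rewrite (last_nth lam) (size_chain cn).
under eq_bigr do rewrite ffunE.
suff: forall m, (m <= n)%N ->
  (\sum_(r < m) (part (nth lam (lam :: c) r) 1 - part (nth lam c r) 1)
   + part (nth lam (lam :: c) m) 1 = part lam 1)%N by exact.
elim=> [|m IHm] mn; first by rewrite big_ord0.
rewrite big_ord_recr /= -addnA subnK ?IHm //; first exact: ltnW.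
exact: (mem_subparts _ _ (chain_step _ cn mn)).
Qed.

Lemma Fs_chain_sum (n : nat) (lam mu : intpart) (kappa : n.-tuple K)
    (P : param_pair K) :
  Fs q lam mu kappa P =
  chain_sum K n (fun r => row_weight P (nth 0 kappa r) r.+1) lam mu.
Proof.
have lamL : (size lam < columns lam mu)%N by rewrite ltnS leq_maxl.
have muL : (size mu < columns lam mu)%N by rewrite ltnS leq_maxr.
rewrite (chain_sumE _ lam) -[RHS](fsbig_fiber (chains n lam)
  (fun c => last lam c == mu) (chain_input n lam)
  [set a : {ffun 'I_n -> nat} | (\sum_(i < n) a i + part mu 1 = part lam 1)%N]).
  apply: eq_fsbigr => a _; rewrite ZW_chains // big_distrr /=.
  rewrite big_seq_cond [RHS]big_seq_cond.
  apply: eq_bigr => c /and3P[cn _ /eqP <-].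
  rewrite -big_split /=; apply: eq_bigr => r _.
  have rn := ltn_ord r.
  rewrite -tnth_nth (row_weight_widen _ _ _ _ _ (columns lam mu)) ?ffunE //.
    exact: chain_step cn rn.
  apply: leq_trans (ltnW lamL); apply: size_subparts.
  exact: chain_le cn (ltnW rn).
by move=> c cn /eqP <- /=; exact: sum_chain_input.
Qed.

(** Shifting translates xi_i s_i by m and fixes xi_i / s_i; row weights involve only these and
    further shifts, which compose. *)
Lemma chain_sum_shift (n m : nat) (ks : seq K) (P : param_pair K) lam mu :
  (forall i, sqrt_prod P i != 0) -> (forall i, sqrt_quot P i != 0) ->
  chain_sum K n (fun r => row_weight (shift_pair m P) (nth 0 ks r) r.+1) lam mu =
  chain_sum K n (fun r => row_weight P (nth 0 ks r) (m + r.+1)) lam mu.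
Proof.
move=> p0 u0; apply: eq_chain_sum => r al be _.
have ss_xi i : ss (shift_pair m P) i * xi (shift_pair m P) i
    = ss P (m + i)%N * xi P (m + i)%N.
  by rewrite /ss /xi /= (addnC i) mulrACA mulVf // mulr1 mulrACA mulVf ?mulr1.
have ss_xi0 : ss (shift_pair m P) 0 / xi (shift_pair m P) 0 = ss P 0 / xi P 0.
  by rewrite /ss /xi /= !invfM [LHS]mulrACA [RHS]mulrACA !divff.
set kap := nth 0 ks r; congr (_ * _).
  by rewrite /boundary_weight -!(mulrA kap) -!(mulrA kap^-1) ss_xi ss_xi0.
apply: eq_bigr => c _; rewrite /column_weight shift_pair_add.
by rewrite [xi _ _ * _]mulrC ss_xi addnA [ss P _ * _]mulrC.
Qed.

End Branching.

(** * Normalization and branching *)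

Lemma normalization_neq0 {K : fieldType} (q : K) (s : nat -> K) (lam : intpart) :
  (forall j : nat, q ^+ j.+1 != 1) -> (forall i, s i != 0) ->
  (forall i j : nat, s i ^+ 2 * q ^+ j != 1) ->
  neg_pow s lam * cnorm q s lam != 0.
Proof.
move=> hq s0 hs; have qpoch_neq0 x n : (forall j, x * q ^+ j != 1) -> qpoch q x n != 0.
  by move=> hx; apply/prodf_neq0 => j _; rewrite subr_eq0 eq_sym.
apply: mulf_neq0; rewrite prodf_seq_neq0; apply/allP => i _ /=.
  by rewrite expf_neq0 // oppr_eq0.
rewrite mulf_neq0 ?invr_neq0 ?qpoch_neq0 // => j.
by rewrite -exprS.
Qed.

Theorem proposition5p5 (K : fieldType) (q : K)
    (sqrt_xi sqrt_s : nat -> K) (n m : nat) (kappa : n.-tuple K)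
    (lam mu : intpart) (P := pair_of_roots sqrt_xi sqrt_s)
    (* genericity: no denominator vanishes *)
    (hq : forall j : nat, q ^+ j.+1 != 1)
    (hxi : forall i : nat, sqrt_xi i != 0)
    (hs : forall i : nat, sqrt_s i != 0)
    (hss : forall i k j : nat, ss (shift_pair k P) i ^+ 2 * q ^+ j != 1)
    (hkappa : forall i : 'I_n, tnth kappa i != 0)
    (hm : (1 <= m < n)%N) :
  let term (nu : intpart) : K :=
    FF q lam nu [tuple of take m kappa] P
    * FF q nu mu [tuple of drop m kappa] (shift_pair m P) in
  finite_set [set nu | term nu != 0] /\
  FF q lam mu kappa P = \sum_(nu \in [set: intpart]) term nu.
Proof.
move=> term; have [_ mn] := andP hm.
have p0 i : sqrt_prod P i != 0 by rewrite mulf_neq0.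
have u0 i : sqrt_quot P i != 0 by rewrite mulf_neq0 ?invr_neq0.
(* [norm k] normalizes a partition lying k rows below the top; [FF] carries a quotient of two such
   factors. *)
pose norm k nu := neg_pow (ss (shift_pair k P)) nu * cnorm q (ss (shift_pair k P)) nu.
have ss_shift0 : ss (shift_pair 0 P) = ss P.
  by apply/funext => i; rewrite /ss /= addn0.
pose w r := row_weight K q P (nth 0 kappa r) r.+1.
have FFE (l : nat) (kap : l.-tuple K) al be k : FF q al be kap (shift_pair k P) =
    norm (k + l)%N be / norm k al * Fs q al be kap (shift_pair k P).
  by rewrite /FF shift_pair_add mulf_div.
have FF0 (l : nat) (kap : l.-tuple K) al be : FF q al be kap P =
    norm l be / norm 0%N al * Fs q al be kap P.
  by rewrite /FF /norm ss_shift0 mulf_div.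
have norm0 k nu : norm k nu != 0.
  apply: normalization_neq0 => [//|i|i j]; last exact: hss.
  by apply: mulf_neq0; [exact: p0|rewrite invr_neq0 ?u0].
have termE nu : term nu = norm n mu / norm 0%N lam *
    (chain_sum K m w lam nu * chain_sum K (n - m) (fun r => w (m + r)%N) nu mu).
  rewrite /term FF0 FFE !Fs_chain_sum chain_sum_shift // subnKC ?(ltnW mn) //=.
  rewrite (minn_idPl (ltnW mn)) (eq_chain_sum _ _ _ w); last first.
    by move=> r al be rm; rewrite nth_take.
  rewrite (eq_chain_sum _ (n - m) _ (fun r => w (m + r)%N)); last first.
    by move=> r al be rm; rewrite nth_drop addnS.
  (* [norm m nu] is the numerator in one factor and the denominator in the other, so it cancels. *)
  by rewrite mulrACA; congr (_ * _); rewrite mulrC mulrA divfK.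
have term0 nu : nu \notin subparts lam -> term nu = 0.
  by move=> nul; rewrite termE chain_sum_eq0 // mul0r mulr0.
split.
  apply: (@sub_finite_set _ _ [set` subparts lam]) => // nu /=.
  by apply: contraNT => /term0 ->.
rewrite (fsbig_finite (subparts lam)) ?uniq_subparts //; last by move=> nu _; exact: term0.
rewrite FF0 Fs_chain_sum -[in chain_sum K n](subnKC (ltnW mn)) chain_sumD big_distrr.
by apply: eq_bigr => nu _; rewrite termE.
Qed.
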